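(* Let $p\ge1$ be an integer, let $\mathbf{c}\in C^p(\Omega)$ be a velocity field and $u_0\in C^p(\Omega)$, and let $u$ be the solution of $$\partial_tu(x,t)+\mathbf{c}(x)\cdot\nabla u(x,t)=0,\qquad u(x,0)=u_0(x),\qquad (x,t)\in\Omega\times[0,T].$$ Then for each $\varepsilon>0$ there exists a subspace $V=V_\varepsilon\subset L^2(\Omega)$, of dimension $o(\varepsilon^{-2/p})$ as $\varepsilon\to0$, such that $$\sqrt{\int_0^T\|P_Vu(\cdot,t)-u(\cdot,t)\|_{L^2(\Omega)}^2\,dt}\le\varepsilon.$$
   Context: $\Omega=[0,2\pi]^d$ with periodic boundary conditions (the $d$-torus); functions in $C^p(\Omega)$ are periodic; $\mathbf{c}:\Omega\to\mathbb{R}^d$; $0<T<\infty$. $P_V$ denotes the orthogonal projection of $L^2(\Omega)$ onto $V$. *)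

(* Defs.v *)
From HB Require Import structures.
From mathcomp Require Import all_boot all_order all_algebra.
From mathcomp Require Import all_classical all_reals all_analysis.

Set Implicit Arguments.
Unset Strict Implicit.
Unset Printing Implicit Defensive.

Import Order.TTheory GRing.Theory Num.Theory.
Import numFieldNormedType.Exports.

Local Open Scope classical_set_scope.
Local Open Scope ring_scope.

Definition rV_display : measure_display -> measure_display.
Proof. exact. Qed.

Definition rV_coord (R : realType) d (i : 'I_d) (x : 'rV[R]_d) : R := x ord0 i.

(* The sigma-algebra generated by the coordinates, i.e. the Borel one. *)
Section measurable_rV.
Context {R : realType} {d : nat}.

Let coord := @rV_coord R d.

Let rV_set0 : g_sigma_preimage coord set0.
Proof. exact: sigma_algebra0. Qed.

Let rV_setC A : g_sigma_preimage coord A -> g_sigma_preimage coord (~` A).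
Proof. exact: sigma_algebraC. Qed.

Let rV_bigcup (F : (set 'rV[R]_d)^nat) :
  (forall i, g_sigma_preimage coord (F i)) ->
  g_sigma_preimage coord (\bigcup_i F i).
Proof. exact: sigma_algebra_bigcup. Qed.

HB.instance Definition _ := @isMeasurable.Build
  (rV_display default_measure_display)
  'rV[R]_d (g_sigma_preimage coord) rV_set0 rV_setC rV_bigcup.

End measurable_rV.

Lemma measurable_rV_coord (R : realType) d (i : 'I_d) :
  measurable_fun [set: 'rV[R]_d] (@rV_coord R d i).
Proof.
move=> _ Y mY; rewrite setTI; apply: sub_sigma_algebra => /=.
rewrite -bigcup_seq/=; exists i => /=; first by rewrite mem_index_enum.
by exists Y => //; rewrite setTI.
Qed.

Lemma measurable_fun_rV (R : realType) d dT (T : measurableType dT)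
    (f : T -> 'rV[R]_d) :
  (forall i, measurable_fun [set: T] (@rV_coord R d i \o f)) ->
  measurable_fun [set: T] f.
Proof.
move=> mf.
suff S : g_sigma_preimage (fun i => @rV_coord R d i \o f) `<=` measurable.
  move=> _ A mA; apply: S; rewrite g_sigma_preimage_comp.
  by exists A.
apply: smallest_sub; first exact: sigma_algebra_measurable.
case: d f mf => [|n] f mf; first by rewrite big_ord0.
rewrite -bigcup_mkord_ord; apply: bigcup_sub => i Ii.
by move=> A [B mB <-]; exact: mf.
Qed.

Section lebesgue_rV.
Context {R : realType}.

Definition rV_cons n (z : measurableTypeR R * 'rV[R]_n) : 'rV[R]_n.+1 :=
  \row_i oapp (z.2 ord0) z.1 (unlift ord0 i).

Definition rV_uncons n (x : 'rV[R]_n.+1) : measurableTypeR R * 'rV[R]_n :=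
  (x ord0 ord0, \row_i x ord0 (lift ord0 i)).

Lemma rV_consK n : cancel (@rV_cons n) (@rV_uncons n).
Proof.
move=> [a v]; rewrite /rV_uncons /rV_cons mxE unlift_none/=; congr pair.
by apply/rowP => i; rewrite !mxE liftK.
Qed.

Lemma measurable_rV_cons n : measurable_fun [set: _] (@rV_cons n).
Proof.
apply: measurable_fun_rV => i.
rewrite (_ : _ \o _ = fun z : measurableTypeR R * 'rV[R]_n =>
    oapp (z.2 ord0) z.1 (unlift ord0 i)); last first.
  by apply/funext => z /=; rewrite /rV_coord mxE.
case: unliftP => [j _|_] /=; last exact: measurable_fst.
by apply: (measurableT_comp (@measurable_rV_coord R n j)); exact: measurable_snd.
Qed.

Lemma measurable_rV_uncons n : measurable_fun [set: _] (@rV_uncons n).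
Proof.
apply/measurable_fun_pairP; split => /=.
  exact: (@measurable_rV_coord R n.+1 ord0).
apply: measurable_fun_rV => i.
rewrite (_ : _ \o _ = @rV_coord R n.+1 (lift ord0 i)).
  exact: measurable_rV_coord.
by apply/funext => x /=; rewrite /rV_coord mxE.
Qed.

Section step.
Context {n : nat}.
Variable m : {sigma_finite_measure set 'rV[R]_n -> \bar R}.

Definition lebesgue_rVS : set 'rV[R]_n.+1 -> \bar R :=
  pushforward (@lebesgue_measure R \x m)%E (@rV_cons n).

Let mcons := @measurable_rV_cons n.

Let lebesgue_rVS0 : lebesgue_rVS set0 = 0%E.
Proof. by rewrite /lebesgue_rVS/= /pushforward preimage_set0 measure0. Qed.

Let lebesgue_rVS_ge0 A : (0 <= lebesgue_rVS A)%E.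
Proof. exact: measure_ge0. Qed.

Let lebesgue_rVS_sigma_additive : semi_sigma_additive lebesgue_rVS.
Proof.
move=> F mF tF mUF; rewrite /lebesgue_rVS /pushforward preimage_bigcup.
apply: (@measure_semi_sigma_additive _ _ _ (lebesgue_measure \x m)%E).
- by move=> k; rewrite -[X in measurable X]setTI; exact: mcons.
- apply/trivIsetP => /= i j _ _ ij; rewrite -preimage_setI.
  by move/trivIsetP : tF => /(_ _ _ _ _ ij) ->//; rewrite preimage_set0.
- by rewrite -preimage_bigcup -[X in measurable X]setTI; exact: mcons.
Qed.

HB.instance Definition _ := isMeasure.Build _ _ _ lebesgue_rVS
  lebesgue_rVS0 lebesgue_rVS_ge0 lebesgue_rVS_sigma_additive.

Let lebesgue_rVS_sigma_finite : sigma_finite setT lebesgue_rVS.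
Proof.
have /sigma_finiteP[F [FT ndF mF]] := sigma_finiteT (@lebesgue_measure R).
have /sigma_finiteP[G [GT ndG mG]] := sigma_finiteT m.
exists (fun k => @rV_uncons n @^-1` (F k `*` G k)).
  rewrite -preimage_bigcup (_ : \bigcup_k (F k `*` G k) = setT)//.
  rewrite -setXTT FT GT predeqE => -[x y]; split.
    by move=> [k _ []/= ? ?]; split; exists k.
  move=> [/= [i _ Fix] [j _ Gjy]]; exists (maxn i j) => //; split.
    by move: x Fix; exact/subsetPset/ndF/leq_maxl.
  by move: y Gjy; exact/subsetPset/ndG/leq_maxr.
move=> k; have [mFk Fk] := mF k; have [mGk Gk] := mG k; split.
  rewrite -[X in measurable X]setTI; apply: measurable_rV_uncons => //.
  exact: measurableX.
rewrite /lebesgue_rVS /pushforward -comp_preimage.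
rewrite (_ : _ \o _ = id); last by apply/funext => z /=; rewrite rV_consK.
by rewrite preimage_id product_measure1E// lte_mul_pinfty// ge0_fin_numE.
Qed.

HB.instance Definition _ := @Measure_isSigmaFinite.Build _ _ _
  lebesgue_rVS lebesgue_rVS_sigma_finite.

End step.

(* The d-fold product of the Lebesgue measure on R. *)
Fixpoint lebesgue_rV d : {sigma_finite_measure set 'rV[R]_d -> \bar R} :=
  match d return {sigma_finite_measure set 'rV[R]_d -> \bar R} with
  | 0 => \d_(0 : 'rV[R]_0)
  | n.+1 => lebesgue_rVS (lebesgue_rV n)
  end.

Lemma measurable_rV_box d (A : 'I_d -> set R) : (forall i, measurable (A i)) ->
  measurable [set x : 'rV[R]_d | forall i, A i (x ord0 i)].
Proof.
move=> mA.
rewrite (_ : [set _ | _] = \big[setI/setT]_(i < d) (@rV_coord R d i @^-1` A i)).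
  apply: bigsetI_measurable => i _; rewrite -[X in measurable X]setTI.
  exact: measurable_rV_coord.
rewrite -bigcap_seq; apply/seteqP; split => x /= xA i; first by move=> _; exact: xA.
by apply: xA; rewrite /= mem_index_enum.
Qed.

Lemma lebesgue_rV_box d (A : 'I_d -> set R) : (forall i, measurable (A i)) ->
  lebesgue_rV d [set x | forall i, A i (x ord0 i)] =
  (\prod_i lebesgue_measure (A i))%E.
Proof.
elim: d A => [|d IH] A mA.
  rewrite big_ord0 /= diracE mem_set// => -[]//.
rewrite big_ord_recl -IH// /= /lebesgue_rVS /pushforward.
have mA0 : measurable (A ord0 : set (measurableTypeR R)) by exact: mA.
have mB := measurable_rV_box (fun i => mA (lift ord0 i)).
rewrite -product_measure1E//.
congr (_ _); apply/seteqP; split => -[a v] /=.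
  move=> vA; split; first by have := vA ord0; rewrite /rV_cons mxE unlift_none.
  by move=> i; have := vA (lift ord0 i); rewrite /rV_cons mxE liftK.
move=> [aA vA] i; rewrite /rV_cons mxE.
by case: unliftP => [j ->|->] //=; exact: vA.
Qed.

End lebesgue_rV.

Section torus.
Context {R : realType} {d : nat}.

(* The fundamental domain [0, 2pi]^d. Functions on the torus are represented
   by periodic functions on R^d. *)
Definition torus_box : set 'rV[R]_d :=
  [set x | forall i, x ord0 i \in `[0, 2 * pi]].

Lemma measurable_torus_box : measurable torus_box.
Proof.
exact: (@measurable_rV_box R d (fun=> [set` `[0, 2 * pi]])).
Qed.

Definition torus_measure : {measure set 'rV[R]_d -> \bar R} :=
  mrestr (lebesgue_rV d) measurable_torus_box.

Definition torus_periodic (W : Type) (f : 'rV[R]_d -> W) : Prop :=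
  forall x i, f (x + (2 * pi) *: delta_mx ord0 i) = f x.

(* Partial derivatives up to order k exist and are continuous. *)
Fixpoint Ck (k : nat) (f : 'rV[R]_d -> R) : Prop :=
  if k is k'.+1 then
    continuous f /\
    forall i, (forall x, derivable f x (delta_mx ord0 i)) /\
              Ck k' ('D_(delta_mx ord0 i) f)
  else continuous f.

Definition torus_Ck (k : nat) (f : 'rV[R]_d -> R) : Prop :=
  torus_periodic f /\ Ck k f.

Definition torus_Ck_field (k : nat) (c : 'rV[R]_d -> 'rV[R]_d) : Prop :=
  torus_periodic c /\ forall i, Ck k (fun x => c x ord0 i).

Definition L2_norm (f : 'rV[R]_d -> R) : \bar R :=
  'N[torus_measure]_2%:E[EFin \o f]%E.

(* The elements of L^2(Omega) are the functions below up to equality almost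
   everywhere; a subset of the quotient is represented by a saturated set. *)
Definition L2 := LfunType torus_measure (lee1n 2).

Definition L2_subspace (V : set L2) : Prop :=
  [/\ V 0,
      forall (a : R) (f g : L2), V f -> V g -> V (a *: f + g) &
      forall f g : L2, V f -> f = g %[ae torus_measure] -> V g].

(* The image of V in L^2(Omega) has a basis with n elements. *)
Definition L2_dim (V : set L2) (n : nat) : Prop :=
  exists b : 'I_n -> L2,
    [/\ forall i, V (b i),
        forall a : 'I_n -> R,
          \sum_i a i *: b i = (0 : L2) %[ae torus_measure] -> forall i, a i = 0 &
        forall f, V f -> exists a : 'I_n -> R,
          f = \sum_i a i *: b i %[ae torus_measure]].

(* P_V f is the element g of V such that f - g is orthogonal to V (unique up to
   equality almost everywhere). *)
Definition L2_proj (V : set L2) (f : 'rV[R]_d -> R) : L2 :=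
  xget 0 [set g : L2 | V g /\
    forall h : L2, V h -> \int[torus_measure]_x ((f x - g x) * h x) = 0].

(* Derivative at t of f restricted to D: one-sided at an end-point of D. *)
Definition derivable_in (D : set R) (f : R -> R) (t : R) : Prop :=
  cvg ((f s - f t) / (s - t) @[s --> within (D `\ t) (nbhs t)]).

Definition derive_in (D : set R) (f : R -> R) (t : R) : R :=
  lim ((f s - f t) / (s - t) @[s --> within (D `\ t) (nbhs t)]).

Definition time_slab (T : R) : set ('rV[R]_d * R) := [set z | z.2 \in `[0, T]].

(* u is C^1 on Omega x [0, T]. *)
Definition C1_spacetime (T : R) (u : 'rV[R]_d -> R -> R) : Prop :=
  [/\ {within time_slab T, continuous (fun z => u z.1 z.2)},
      forall x t i, t \in `[0, T] -> derivable (u ^~ t) x (delta_mx ord0 i),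
      forall i, {within time_slab T,
        continuous (fun z => 'D_(delta_mx ord0 i) (u ^~ z.2) z.1)},
      forall x t, t \in `[0, T] -> derivable_in `[0, T] (u x) t &
      {within time_slab T,
        continuous (fun z => derive_in `[0, T] (u z.1) z.2)}].

Definition transport_solution (T : R) (c : 'rV[R]_d -> 'rV[R]_d)
    (u0 : 'rV[R]_d -> R) (u : 'rV[R]_d -> R -> R) : Prop :=
  [/\ forall t, t \in `[0, T] -> torus_periodic (u ^~ t),
      C1_spacetime T u,
      forall x t, t \in `[0, T] ->
        derive_in `[0, T] (u x) t +
        \sum_i c x ord0 i * 'D_(delta_mx ord0 i) (u ^~ t) x = 0 &
      forall x, u x 0 = u0 x].

End torus.

Arguments L2 : clear implicits.

(* Main.v *)
Require Import Defs.
From mathcomp Require Import all_boot all_order all_algebra.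
From mathcomp Require Import all_classical all_reals all_analysis.
From mathcomp Require Import measurable_realfun ring lra.

Set Implicit Arguments.
Unset Strict Implicit.
Unset Printing Implicit Defensive.

Import Order.TTheory GRing.Theory Num.Theory.
Import numFieldNormedType.Exports.

Local Open Scope classical_set_scope.
Local Open Scope ring_scope.

(** The solution u is never represented along characteristics.  Everything rests
    on two facts: the equation is linear with coefficients independent of time,
    and a solution of the transport equation obeys the maximum principle
    ([maximum_principle]): its supremum over the torus grows at most at the rate
    given by the source.

    Near time 0, the time derivatives of u are (- c . grad)^j u0, which makes
    sense for j <= p because c and u0 are C^p.  The Taylor polynomial built from
    them solves the equation up to a source of order t^(p-1), so by the maximum
    principle it approximates u uniformly in x up to O(t^p)
    ([taylor_remainder]).  Consequently, interpolating u(x, .) on [0, h] by a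
    polynomial of degree < p in time makes an error O(h^p), uniformly in x.  But
    the interpolation error based at time t is itself a solution of the
    homogeneous equation as a function of x and t, so the maximum principle
    carries this estimate from base time 0 to any base time
    ([snapshot_interpolation]).

    Hence the span of the snapshots of u at N p equidistant times, which has
    dimension at most N p, approximates every u(., t) uniformly, and a fortiori
    in L^2, up to O(N^(-p)) ([snapshot_space]).  An error eps is reached with N
    of order eps^(-1/p), and eps^(-1/p) = o(eps^(-2/p)) ([little_o_rate]).

    What remains is to give the statement its meaning in L^2: continuous
    functions are measurable for the sigma-algebra generated by the coordinates
    ([continuous_measurable_rV]), finite spans have a basis modulo null
    functions ([basis_of_span_mod]), and orthogonal projections onto them exist
    and minimise the distance ([orthogonal_projection], [L2_proj_span_le]). *)

(** * Left derivatives and the maximum principle *)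

Section calculus.
Context {R : realType}.

Lemma derive_at_global_max (V : normedModType R) (f : V -> R) (x v : V) :
  derivable f x v -> (forall y, f y <= f x) -> 'D_v f x = 0.
Proof.
move=> dfx fmax; apply/eqP; rewrite eq_le; apply/andP; split.
- rewrite ['D_v f x]cvg_at_rightE; last exact: dfx.
  apply: limr_le.
    by apply: cvgP; apply: cvg_dnbhs_at_right; exact: dfx.
  near=> h; apply: mulr_ge0_le0; last by rewrite subr_le0; exact: fmax.
  by rewrite invr_ge0; near: h; exact: nbhs_right_ge.
- rewrite ['D_v f x]cvg_at_leftE; last exact: dfx.
  apply: limr_ge.
    by apply: cvgP; apply: cvg_dnbhs_at_left; exact: dfx.
  near=> h; apply: mulr_le0; last by rewrite subr_le0; exact: fmax.
  by rewrite invr_le0; near: h; exact: nbhs_left_le.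
Unshelve. all: by end_near. Qed.

(** Time derivatives enter the maximum principle only through the sign of the
    difference quotients to the left of a maximum.  Left derivatives exist at
    the final time as well, and they are invariant under translation, which
    makes it harmless to shift the time origin of a solution. *)
Definition left_derivative (f : R -> R) (t l : R) : Prop :=
  (f s - f t) / (s - t) @[s --> t^'-] --> l.

Lemma left_derivative_ge0 (f : R -> R) (t l a : R) : a < t ->
  (forall s, a <= s <= t -> f s <= f t) -> left_derivative f t l -> 0 <= l.
Proof.
move=> at' fle dl.
have <- := cvg_lim (@Rhausdorff R) dl.
apply: limr_ge; first exact: cvgP dl.
near=> s.
have st : s <= t by near: s; exact: nbhs_left_le.
apply: mulr_le0; last by rewrite invr_le0 subr_le0.
rewrite subr_le0; apply: fle; rewrite st andbT.
by near: s; exact: nbhs_left_ge.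
Unshelve. all: by end_near. Qed.

Lemma left_derivativeD (f g : R -> R) (t k l : R) :
  left_derivative f t k -> left_derivative g t l ->
  left_derivative (f \+ g) t (k + l).
Proof.
move=> df dg; rewrite /left_derivative.
rewrite (_ : (fun s => _) =
    (fun s => (f s - f t) / (s - t)) \+ (fun s => (g s - g t) / (s - t))).
  exact: cvgD.
by apply/funext => s /=; rewrite -mulrDl; congr (_ / _); ring.
Qed.

Lemma left_derivativeZ (a : R) (f : R -> R) (t l : R) :
  left_derivative f t l -> left_derivative (fun s => a * f s) t (a * l).
Proof.
move=> df; rewrite /left_derivative.
rewrite (_ : (fun s => _) = (fun s => a * ((f s - f t) / (s - t)))).
  exact: cvgM (cvg_cst a) df.
by apply/funext => s /=; rewrite mulrA mulrBr.
Qed.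

Lemma left_derivative_cst (a t : R) : left_derivative (fun=> a) t 0.
Proof.
rewrite /left_derivative.
under eq_fun do rewrite subrr mul0r.
exact: cvg_cst.
Qed.

Lemma left_derivative_shift (a : R) (f : R -> R) (t l : R) :
  left_derivative f (t + a) l -> left_derivative (fun s => f (s + a)) t l.
Proof.
move=> /cvg_at_leftP dl; apply/cvg_at_leftP => v [vt vcvg].
rewrite (_ : (fun n => _) =
  (fun n => (f (v n + a) - f (t + a)) / (v n + a - (t + a)))).
  apply: (dl (fun n => v n + a)); split; first by move=> n; rewrite ltrD2r.
  exact: cvgD vcvg (cvg_cst _).
by apply/funext => n; congr (_ / _); ring.
Qed.

Lemma is_derive_left (f : R -> R) (t l : R) :
  is_derive t 1 f l -> left_derivative f t l.
Proof.
move=> [df dl].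
have : h^-1 *: ((f \o shift t) (h *: 1) - f t) @[h --> 0^'-] --> l.
  by apply: cvg_dnbhs_at_left; rewrite -dl; exact: df.
move=> /cvg_at_leftP {}dl; apply/cvg_at_leftP => v [vt vcvg].
rewrite (_ : (fun n => _) = (fun n =>
    (v n - t)^-1 *: ((f \o shift t) ((v n - t) *: 1) - f t))).
  apply: (dl (fun n => v n - t)); split; first by move=> n; rewrite subr_lt0.
  by rewrite -(subrr t); exact: cvgB vcvg (cvg_cst _).
apply/funext => n /=; rewrite [_ *: 1]mulr1 subrK [RHS]mulrC//.
Qed.

(** A derivative relative to [0, T] is in particular a left derivative at every
    point of ]0, T].  The second function g only has to agree with f on [0, T];
    it will be an extension of f to the whole line. *)
Lemma derive_in_left (T : R) (f g : R -> R) (t : R) : 0 < t <= T ->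
  {in `[0, T], f =1 g} -> derivable_in `[0, T] f t ->
  left_derivative g t (derive_in `[0, T] f t).
Proof.
move=> /andP[t0 tT] fg df.
have : (f s - f t) / (s - t) @[s --> t^'-] --> derive_in `[0, T] f t.
  apply: cvg_trans df.
  move=> A nA.
  have nD : \forall s \near t^'-, (`[0, T] `\ t) s.
    near=> s; split; last first.
      by apply/eqP; rewrite lt_eqF//; near: s; exact: nbhs_left_lt.
    rewrite /= in_itv/=; apply/andP; split.
      by near: s; exact: nbhs_left_ge.
    by rewrite (le_trans _ tT)//; near: s; exact: nbhs_left_le.
  rewrite /nbhs/= /fmap/= /within/= in nA *.
  have nA' : \forall s \near t^'-,
      (`[0, T] `\ t) s -> A ((f s - f t) / (s - t)).
    exact: (cvg_within (fun u => u < t) nA).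
  by apply: filter_app nA'; apply: filterS nD => s Ds; exact.
apply: cvg_trans; apply: near_eq_cvg.
near=> s.
have st : s <= t by near: s; exact: nbhs_left_le.
have s0 : 0 <= s by near: s; exact: nbhs_left_ge.
by rewrite !fg// in_itv/= ?tT ?(ltW t0) ?s0 ?(le_trans st).
Unshelve. all: by end_near. Qed.

End calculus.

Section torus_functions.
Context {R : realType} {d : nat}.
Implicit Types (x : 'rV[R]_d) (c : 'rV[R]_d -> 'rV[R]_d).

Let twopi_gt0 : 0 < 2 * pi :> R.
Proof. by rewrite mulr_gt0// pi_gt0. Qed.

Lemma torus_periodic_int (W : Type) (f : 'rV[R]_d -> W) x (k : int) i :
  torus_periodic f -> f (x + (k%:~R * (2 * pi)) *: delta_mx ord0 i) = f x.
Proof.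
move=> pf; pose e : 'rV[R]_d := (2 * pi) *: delta_mx ord0 i.
have fn y n : f (y + e *+ n) = f y.
  by elim: n => [|n IH]; rewrite ?mulr0n ?addr0// mulrSr addrA pf.
rewrite -scalerA -/e; case: k => n.
  by rewrite -[Posz n]/(n%:Z) -pmulrn scaler_nat fn.
by rewrite NegzE rmorphN/= scaleNr -pmulrn scaler_nat -[LHS](fn _ n.+1) subrK.
Qed.

(** One representative y serves all periodic functions at once, including those
    with values in an arbitrary type. *)
Lemma torus_box_repr x : exists2 y, torus_box y &
  forall (W : Type) (f : 'rV[R]_d -> W), torus_periodic f -> f y = f x.
Proof.
pose k i := Num.floor (x ord0 i / (2 * pi)).
exists (x - \sum_i ((k i)%:~R * (2 * pi)) *: delta_mx ord0 i).
  move=> i; rewrite !mxE summxE (bigD1 i)//= !mxE !eqxx mulr1 big1 => [|j ji].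
    have /andP[k1 k2] := floor_itv (x ord0 i / (2 * pi)).
    rewrite addr0 in_itv/= subr_ge0 lerBlDr -ler_pdivlMr//.
    rewrite k1/= -{1}[2 * pi]mul1r -mulrDl -ler_pdivrMr// addrC.
    by have := ltW k2; rewrite intrD.
  by rewrite !mxE eqxx eq_sym (negbTE ji) mulr0.
move=> W f pf; rewrite -sumrN.
elim/big_rec : _ => [|i y _ <-]; first by rewrite addr0.
by rewrite addrCA addrC -scaleNr -mulNr -rmorphN/= torus_periodic_int.
Qed.

Lemma compact_torus_box : compact (@torus_box R d).
Proof.
have := @rV_compact R d (fun=> [set` `[0, 2 * pi]]).
by apply => i; exact: segment_compact.
Qed.

Lemma torus_box0 : @torus_box R d 0.
Proof. by move=> i; rewrite mxE in_itv/= lexx ltW. Qed.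

(** The equation w_t + c . grad w = f, solved for w_t, together with exactly the
    regularity that the maximum principle consumes.  Continuity is asked on all
    of space-time, so that no argument about w has to be relativised to the
    slab; the clamped extension below makes this harmless. *)
Definition transport_with_source c (S : R) (w f : 'rV[R]_d -> R -> R) : Prop :=
  [/\ continuous (fun z : 'rV[R]_d * R => w z.1 z.2),
      forall t, 0 <= t <= S -> torus_periodic (w ^~ t),
      forall x t i, 0 <= t <= S -> derivable (w ^~ t) x (delta_mx ord0 i) &
      forall x t, 0 < t <= S -> left_derivative (w x) t
        (f x t - \sum_i c x ord0 i * 'D_(delta_mx ord0 i) (w ^~ t) x)].

(** After subtracting (M + r) t with r > 0, the function reaches its maximum
    over the slab, by periodicity and compactness of the box.  At a maximum with
    t > 0 the gradient vanishes and the left derivative in time is nonnegative,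
    whereas the equation makes it at most - r; so the maximum is at t = 0. *)
Lemma maximum_principle c (S : R) w f (A M : R) :
  transport_with_source c S w f -> (forall x t, 0 < t <= S -> f x t <= M) ->
  (forall x, w x 0 <= A) ->
  forall x t, 0 <= t <= S -> w x t <= A + M * t.
Proof.
move=> [cw pw dw lw] fM wA x t tS.
apply/ler_addgt0Pr => e e0.
have /andP[t0 tS'] := tS; have S0 : 0 <= S by exact: le_trans tS'.
have S1 : 0 < S + 1 by rewrite ltr_wpDl.
(* At time t <= S the perturbation r t costs less than e. *)
pose r := e / (S + 1); have r0 : 0 < r by rewrite divr_gt0.
pose v y s := w y s - (M + r) * s.
suff : v x t <= A.
  rewrite /v lerBlDr => /le_trans; apply.
  rewrite mulrDl addrA lerD2l /r -mulrA ler_piMr ?(ltW e0)//.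
  by rewrite mulrC ler_pdivrMr// mul1r (le_trans tS')// lerDl.
have cv : continuous (fun z : 'rV[R]_d * R => v z.1 z.2).
  move=> z; apply: cvgB; first exact: cw.
  by apply: cvgM; [exact: cvg_cst|exact: cvg_snd].
have K0 : @torus_box R d `*` [set` `[0, S]] !=set0.
  by exists (0, 0); split; [exact: torus_box0|rewrite /= in_itv/= lexx].
have [[y s]] := compact_EVT_max K0
  (compact_setX compact_torus_box (@segment_compact R 0 S))
  (continuous_subspaceT cv).
move=> /set_mem[/= yB]; rewrite in_itv/= => sS vmax.
have {}vmax y' s' : 0 <= s' <= S -> v y' s' <= v y s.
  move=> s'S; have [y'' y''B py''] := torus_box_repr y'.
  rewrite /v -(py'' _ (w ^~ s')); last exact: pw.
  by apply: (vmax (y'', s')); apply/mem_set; split => //=; rewrite in_itv.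
apply: (le_trans (vmax _ _ tS)).
have /andP[] := sS; rewrite le_eqVlt => /predU1P[<- _|s0 sS'].
  by rewrite /v mulr0 subr0.
have Dw0 i : 'D_(delta_mx ord0 i) (w ^~ s) y = 0.
  apply: derive_at_global_max; first exact: dw.
  by move=> y'; have := vmax y' s sS; rewrite /v lerD2r.
have : left_derivative (v y) s (f y s - (M + r)).
  have := lw y s; rewrite s0 sS' => /(_ isT) lwy.
  rewrite (_ : v y = w y \+ (fun s => - (M + r) * id s)); last first.
    by apply/funext => s' /=; rewrite /v mulNr.
  apply: left_derivativeD.
    move: lwy; rewrite big1 ?subr0// => i _; by rewrite Dw0 mulr0.
  rewrite -[X in left_derivative _ _ X]mulr1.
  by apply: left_derivativeZ; apply: is_derive_left.
move=> /(left_derivative_ge0 s0) Mf0.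
have : 0 <= f y s - (M + r).
  apply: Mf0; move=> s' /andP[s'0 s's]; apply: vmax.
  by rewrite s'0 (le_trans s's).
rewrite subr_ge0 => Mf; exfalso.
have := le_trans Mf (fM y s _); rewrite s0 sS' => /(_ isT).
by rewrite gerDl leNgt r0.
Qed.

End torus_functions.

(** * Linearity, translation invariance, and C^k functions *)

Section transport_algebra.
Context {R : realType} {d : nat}.
Implicit Types (x : 'rV[R]_d) (c : 'rV[R]_d -> 'rV[R]_d).

(** The velocity field does not depend on time, so translating a solution in
    time gives a solution. *)
Lemma transport_shift c (S S' a : R) w f : 0 <= a -> S' + a <= S ->
  transport_with_source c S w f ->
  transport_with_source c S' (fun x t => w x (t + a)) (fun x t => f x (t + a)).
Proof.
move=> a0 aS [cw pw dw lw].
have tS t : 0 <= t <= S' -> 0 <= t + a <= S.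
  by move=> /andP[t0 tS']; rewrite addr_ge0//= (le_trans _ aS)// lerD2r.
split.
- move=> z.
  apply: (@continuous_comp _ _ _ (fun z : 'rV[R]_d * R => (z.1, z.2 + a))
    (fun z => w z.1 z.2)); last exact: cw.
  apply: (@cvg_pair _ _ _ (nbhs z) (nbhs z.1) (nbhs (z.2 + a))).
    exact: cvg_fst.
  by apply: cvgD; [exact: cvg_snd|exact: cvg_cst].
- by move=> t /tS; exact: pw.
- by move=> x t i /tS; exact: dw.
- move=> x t /andP[t0 tS']; apply: left_derivative_shift.
  apply: lw; rewrite ltr_wpDr//=.
  by have /tS/andP[] : 0 <= t <= S' by rewrite ltW.
Qed.

Lemma transport_lin c (S a : R) w1 f1 w2 f2 :
  transport_with_source c S w1 f1 -> transport_with_source c S w2 f2 ->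
  transport_with_source c S (fun x t => a * w1 x t + w2 x t)
    (fun x t => a * f1 x t + f2 x t).
Proof.
move=> [cw1 pw1 dw1 lw1] [cw2 pw2 dw2 lw2].
have dw x t i : 0 <= t <= S -> is_derive x (delta_mx ord0 i)
    (fun x => a * w1 x t + w2 x t)
    (a * 'D_(delta_mx ord0 i) (w1 ^~ t) x + 'D_(delta_mx ord0 i) (w2 ^~ t) x).
  move=> tS; have /derivableP d1 := dw1 x t i tS.
  by have /derivableP d2 := dw2 x t i tS; exact: is_deriveD.
split.
- move=> z; apply: cvgD; last exact: cw2.
  by apply: cvgM; [exact: cvg_cst|exact: cw1].
- by move=> t tS x i; rewrite (pw1 t tS) (pw2 t tS).
- by move=> x t i tS; have [] := dw x t i tS.
- move=> x t tS; have tS' : 0 <= t <= S by case/andP: tS => /ltW -> ->.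
  rewrite (_ : _ - _ = a *
      (f1 x t - \sum_i c x ord0 i * 'D_(delta_mx ord0 i) (w1 ^~ t) x) +
      (f2 x t - \sum_i c x ord0 i * 'D_(delta_mx ord0 i) (w2 ^~ t) x)).
    apply: left_derivativeD; last exact: lw2.
    by apply: left_derivativeZ; exact: lw1.
  rewrite mulrBr addrACA -opprD; congr (_ - _).
  rewrite mulr_sumr -big_split/=; apply: eq_bigr => i _.
  have [_ ->] := dw x t i tS'; ring.
Qed.

Lemma transport0 c (S : R) :
  transport_with_source c S (fun _ _ => 0) (fun _ _ => 0).
Proof.
split=> //.
- by move=> z; exact: cvg_cst.
- move=> x t _; rewrite big1 ?subr0; first exact: left_derivative_cst.
  by move=> i _; rewrite derive_cst mulr0.
Qed.

Lemma transport_sum c (S : R) (I : Type) (r : seq I) (a : I -> R) w f :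
  (forall i, transport_with_source c S (w i) (f i)) ->
  transport_with_source c S (fun x t => \sum_(i <- r) a i * w i x t)
    (fun x t => \sum_(i <- r) a i * f i x t).
Proof.
move=> wf; elim: r => [|i r IH].
  rewrite (_ : (fun x t => _) = (fun _ _ => 0)); last first.
    by apply/funext => x; apply/funext => t; rewrite big_nil.
  rewrite (_ : (fun x t => _) = (fun _ _ => 0)); first exact: transport0.
  by apply/funext => x; apply/funext => t; rewrite big_nil.
rewrite (_ : (fun x t => _) =
    (fun x t => a i * w i x t + \sum_(j <- r) a j * w j x t)); last first.
  by apply/funext => x; apply/funext => t; rewrite big_cons.
rewrite [X in transport_with_source _ _ _ X](_ : _ =
    (fun x t => a i * f i x t + \sum_(j <- r) a j * f j x t)).
  exact: transport_lin.
by apply/funext => x; apply/funext => t; rewrite big_cons.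
Qed.

Lemma maximum_principle_norm c (S : R) w f (A M : R) :
  transport_with_source c S w f ->
  (forall x t, 0 < t <= S -> `|f x t| <= M) ->
  (forall x, `|w x 0| <= A) ->
  forall x t, 0 <= t <= S -> `|w x t| <= A + M * t.
Proof.
move=> wf fM wA x t tS; rewrite ler_norml lerNl; apply/andP; split.
  have := transport_lin (-1) wf (transport0 c S).
  move/maximum_principle => /(_ A M _ _ x t tS); rewrite mulN1r addr0; apply.
    move=> y s ys; rewrite mulN1r addr0; apply: le_trans (fM y s ys).
    by rewrite -normrN ler_norm.
  move=> y; rewrite mulN1r addr0; apply: le_trans (wA y).
  by rewrite -normrN ler_norm.
apply: (maximum_principle wf) => // [y s ys|y].
  exact: le_trans (ler_norm _) (fM y s ys).
exact: (le_trans (ler_norm _)).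
Qed.

(** Composing a function on [0, T] with this retraction extends it
    continuously to all times. *)
Definition clamp (T t : R) : R := Num.max 0 (Num.min t T).

Lemma clamp_itv (T t : R) : 0 <= T -> 0 <= clamp T t <= T.
Proof.
by move=> T0; rewrite /clamp le_max lexx/= ge_max T0 ge_min lexx orbT.
Qed.

Lemma clampE (T t : R) : 0 <= t <= T -> clamp T t = t.
Proof. by move=> /andP[t0 tT]; rewrite /clamp min_l// max_r. Qed.

Lemma continuous_clamp (T : R) : continuous (clamp T).
Proof.
apply: (@max_fun_continuous _ R R (cst 0) (id \min cst T)).
  by move=> t; exact: cvg_cst.
by apply: min_fun_continuous => t; [exact: cvg_id|exact: cvg_cst].
Qed.

Lemma transport_solution_clamp (T : R) c u0 u : 0 < T ->
  transport_solution T c u0 u ->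
  transport_with_source c T (fun x t => u x (clamp T t)) (fun _ _ => 0).
Proof.
move=> T0 [pu [cu du _ tu _] eu _].
have itvT t : 0 <= t <= T -> t \in `[0, T] by rewrite in_itv.
split.
- have /subspace_continuousP {}cu := cu.
  move=> z; pose phi (z : 'rV[R]_d * R) := (z.1, clamp T z.2).
  have phiT z' : time_slab T (phi z').
    by rewrite /time_slab/= in_itv/= clamp_itv// ltW.
  have phic : {for z, continuous phi}.
    apply: (@cvg_pair _ _ _ (nbhs z) (nbhs z.1) (nbhs (clamp T z.2))).
      exact: cvg_fst.
    apply: continuous_comp; first exact: cvg_snd.
    exact: continuous_clamp.
  move=> A /(cu (phi z) (phiT z)) /phic.
  rewrite /nbhs/= /fmap/= /within/=; apply: filterS => z' /=; apply.
  exact: phiT.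
- by move=> t tT; rewrite clampE//; apply: pu; exact: itvT.
- by move=> x t i tT; rewrite clampE//; apply: du; exact: itvT.
- move=> x t tT.
  have tT' : 0 <= t <= T by case/andP: tT => /ltW -> ->.
  have -> : 0 - \sum_i c x ord0 i *
      'D_(delta_mx ord0 i) (fun x => u x (clamp T t)) x =
      derive_in `[0, T] (u x) t.
    apply/eqP; rewrite clampE// subr_eq eq_sym.
    by apply/eqP; exact: eu (itvT _ tT').
  apply: derive_in_left => //; last exact: (tu _ _ (itvT _ tT')).
  by move=> s; rewrite in_itv/= => sT; rewrite clampE.
Qed.

End transport_algebra.

Section Ck_algebra.
Context {R : realType} {d : nat}.
Implicit Types (f g : 'rV[R]_d -> R).

Lemma Ck_continuous k f : Ck k f -> continuous f.
Proof. by case: k => [//|k []]. Qed.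

Lemma CkS k f : Ck k.+1 f -> Ck k f.
Proof.
elim: k f => [|k IH] f; first by case.
by move=> [cf df]; split => // i; have [dfi /IH] := df i.
Qed.

Lemma Ck_le k l f : (k <= l)%N -> Ck l f -> Ck k f.
Proof.
move=> /subnK <-; elim: (l - k)%N => [//|n IH].
by rewrite addSn => /CkS.
Qed.

Lemma CkD k f g : Ck k f -> Ck k g -> Ck k (f \+ g).
Proof.
elim: k f g => [|k IH] f g; first by move=> cf cg x; exact: cvgD (cf x) (cg x).
move=> [cf df] [cg dg]; split.
  by move=> x; exact: cvgD (cf x) (cg x).
move=> i; have [dfi Cfi] := df i; have [dgi Cgi] := dg i; split.
  by move=> x; exact: derivableD.
rewrite (_ : 'D_ _ _ = 'D_(delta_mx ord0 i) f \+ 'D_(delta_mx ord0 i) g).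
  exact: IH.
by apply/funext => x; rewrite deriveD.
Qed.

Lemma CkM k f g : Ck k f -> Ck k g -> Ck k (f \* g).
Proof.
elim: k f g => [|k IH] f g; first by move=> cf cg x; exact: cvgM (cf x) (cg x).
move=> /[dup] /CkS Cf [cf df] /[dup] /CkS Cg [cg dg]; split.
  by move=> x; exact: cvgM (cf x) (cg x).
move=> i; have [dfi Cfi] := df i; have [dgi Cgi] := dg i; split.
  by move=> x; exact: derivableM.
rewrite (_ : 'D_ _ _ = (f \* 'D_(delta_mx ord0 i) g) \+
    (g \* 'D_(delta_mx ord0 i) f)).
  by apply: CkD; exact: IH.
by apply/funext => x; rewrite deriveM.
Qed.

Lemma Ck_cst k (a : R) : Ck k (fun _ : 'rV[R]_d => a).
Proof.
elim: k a => [|k IH] a; first exact: cst_continuous.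
split; first exact: cst_continuous.
move=> i; split; first by move=> x; exact: derivable_cst.
rewrite (_ : 'D_ _ _ = fun=> 0); first exact: IH.
by apply/funext => x; rewrite derive_cst.
Qed.

Lemma Ck_sum k (I : Type) (r : seq I) (f : I -> 'rV[R]_d -> R) :
  (forall i, Ck k (f i)) -> Ck k (fun x => \sum_(i <- r) f i x).
Proof.
move=> Cf; elim: r => [|i r IH].
  rewrite (_ : (fun=> _) = fun=> 0); first exact: Ck_cst.
  by apply/funext => x; rewrite big_nil.
rewrite (_ : (fun=> _) = f i \+ (fun x => \sum_(j <- r) f j x)).
  exact: CkD.
by apply/funext => x; rewrite big_cons.
Qed.

Lemma torus_periodic_derive f (v : 'rV[R]_d) :
  torus_periodic f -> torus_periodic ('D_v f).
Proof.
move=> pf x i; set y := x + _.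
have E : (fun h : R => h^-1 *: ((f \o shift y) (h *: v) - f y)) =
    (fun h => h^-1 *: ((f \o shift x) (h *: v) - f x)).
  by apply/funext => h /=; rewrite /y addrA !pf.
by rewrite /derive E.
Qed.

Lemma torus_bounded f : continuous f -> torus_periodic f ->
  exists2 M, 0 <= M & forall x, `|f x| <= M.
Proof.
move=> cf pf.
have cnf : continuous (fun x => `|f x|).
  move=> x; apply: (@continuous_comp _ _ _ f (fun y : R => `|y|)).
    exact: cf.
  exact: norm_continuous.
have B0 : @torus_box R d !=set0 by exists 0; exact: torus_box0.
have [y _ ymax] := compact_EVT_max B0 compact_torus_box
  (continuous_subspaceT cnf).
exists `|f y|; first exact: normr_ge0.
move=> x; have [x' x'B <-] := torus_box_repr x; last exact: pf.
by apply: ymax; exact/mem_set.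
Qed.

End Ck_algebra.

(** * Taylor expansion and interpolation in time *)

Section interpolation.
Context {R : realType}.

Lemma horner_bounded01 (q : {poly R}) :
  exists2 K, 0 <= K & forall s, 0 <= s <= 1 -> `|q.[s]| <= K.
Proof.
exists (\sum_(i < size q) `|q`_i|); first exact: sumr_ge0.
move=> s /andP[s0 s1]; rewrite horner_coef.
apply: le_trans (ler_norm_sum _ _ _) _; apply: ler_sum => i _.
by rewrite normrM normrX (ger0_norm s0) ler_piMr// exprn_ile1.
Qed.

(** Lagrange interpolation at the nodes i / p is exact on polynomials of degree
    less than p, and its weights are bounded on [0, 1] since they are
    polynomials. *)
Lemma interpolation_weights (p : nat) : (0 < p)%N ->
  exists (a : 'I_p -> R -> R) (K : R),
    [/\ 0 <= K, forall i s, 0 <= s <= 1 -> `|a i s| <= K &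
    forall (q : {poly R}) s, (size q <= p)%N ->
      q.[s] = \sum_i a i s * q.[i%:R / p%:R]].
Proof.
move=> p0; pose node (i : nat) : R := i%:R / p%:R.
have node_inj : injective node.
  move=> i j /divIf; rewrite pnatr_eq0 -lt0n p0 => /(_ isT)/eqP.
  by rewrite eqr_nat => /eqP.
pose l i : {poly R} := tnth (lagrange p node) i.
have /choice[K Kl] i : exists K,
    0 <= K /\ forall s, 0 <= s <= 1 -> `|(l i).[s]| <= K.
  by have [K K0 lK] := horner_bounded01 (l i); exists K.
exists (fun i s => (l i).[s]), (\sum_i K i); split.
- by apply: sumr_ge0 => i _; case: (Kl i).
- move=> i s s01; rewrite (bigD1 i)//= ler_wpDr//; last exact: (Kl i).2.
  by apply: sumr_ge0 => j _; case: (Kl j).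
- move=> q s sq; rewrite {1}(lagrange_gen p0 node_inj sq) horner_sum.
  by apply: eq_bigr => i _; rewrite hornerM hornerC mulrC.
Qed.

End interpolation.

Section taylor.
Context {R : realType} {d : nat}.
Implicit Types (x : 'rV[R]_d).
Variables (c : 'rV[R]_d -> 'rV[R]_d) (u0 : 'rV[R]_d -> R) (p : nat).
Hypothesis (p0 : (0 < p)%N) (hc : torus_Ck_field p c) (hu0 : torus_Ck p u0).

(** The j-th derivative in time of the solution at time 0, read off from the
    equation: it is obtained from u0 by applying - c . grad j times. *)
Fixpoint time_derivative0 (j : nat) : 'rV[R]_d -> R :=
  if j is j'.+1 then
    fun x => \sum_i (- c x ord0 i) *
      'D_(delta_mx ord0 i) (time_derivative0 j') x
  else u0.

Local Notation g := time_derivative0.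

Lemma time_derivative0_Ck j : (j <= p)%N -> Ck (p - j) (g j).
Proof.
elim: j => [_|j IH jp]; first by rewrite subn0; case: hu0.
have := IH (ltnW jp); rewrite -subSS subSn// => -[_ dg] /=.
apply: Ck_sum => i; apply: (CkM (f := fun x => - c x ord0 i)); last first.
  exact: (dg i).2.
rewrite (_ : (fun x => _) = (fun=> -1) \* (fun x => c x ord0 i)).
  by apply: CkM; [exact: Ck_cst|apply: Ck_le (hc.2 i); exact: leq_subr].
by apply/funext => x /=; rewrite mulN1r.
Qed.

Lemma time_derivative0_periodic j : torus_periodic (g j).
Proof.
elim: j => [|j IH] /=; first by case: hu0.
move=> x i; apply: eq_bigr => k _.
by rewrite (torus_periodic_derive (delta_mx ord0 k) IH) hc.1.
Qed.

Definition taylor_time (j : nat) (t : R) : R := t ^+ j / (j`!)%:R.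

Lemma left_derivative_taylor_time j t : left_derivative (taylor_time j) t
  (if j is k.+1 then taylor_time k t else 0).
Proof.
case: j => [|j].
  rewrite (_ : taylor_time 0 = fun=> 1); first exact: left_derivative_cst.
  by apply/funext => s; rewrite /taylor_time expr0 fact0 divr1.
rewrite (_ : taylor_time j.+1 =
    fun s => (j.+1)`!%:R^-1 * s ^+ j.+1); last first.
  by apply/funext => s; rewrite /taylor_time mulrC.
rewrite (_ : taylor_time j t = (j.+1)`!%:R^-1 * (j.+1%:R * t ^+ j)); last first.
  rewrite /taylor_time factS natrM; field.
  by rewrite nat1r !pnatr_eq0 -lt0n fact_gt0.
apply: left_derivativeZ; apply: is_derive_left.
have := is_deriveX j.+1 (is_derive_id t (1 : R)).
by rewrite exprfctE /= [_ *: 1]mulr1.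
Qed.

Definition taylor_term (j : nat) x t : R := taylor_time j t * g j x.

(** The time derivative of the j-th Taylor term.  Applying c . grad to that term
    gives the opposite of the drift of the next one, so that the sources of the
    Taylor terms telescope. *)
Definition taylor_drift (j : nat) x t : R :=
  if j is k.+1 then taylor_time k t * g j x else 0.

Lemma taylor_driftS j x t :
  taylor_drift j.+1 x t = taylor_time j t * g j.+1 x.
Proof. by []. Qed.

Lemma transport_taylor_term (S : R) j : (j < p)%N ->
  transport_with_source c S (taylor_term j)
    (fun x t => taylor_drift j x t - taylor_drift j.+1 x t).
Proof.
move=> jp.
have := time_derivative0_Ck (ltnW jp); rewrite -subSS subSn// => -[cg dg].
have dt x t i : is_derive x (delta_mx ord0 i) (taylor_term j ^~ t)
    (taylor_time j t * 'D_(delta_mx ord0 i) (g j) x).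
  by have /derivableP dgx := (dg i).1 x; exact: is_deriveZ.
split.
- move=> z; apply: cvgM.
    apply: cvgM; last exact: cvg_cst.
    apply: (@continuous_comp _ _ _ snd (fun t : R => t ^+ j)).
      exact: cvg_snd.
    exact: exprn_continuous.
  apply: (@continuous_comp _ _ _ fst (g j)); first exact: cvg_fst.
  exact: cg.
- by move=> t _ x i; rewrite /taylor_term time_derivative0_periodic.
- by move=> x t i _; case: (dt x t i).
- move=> x t _.
  rewrite (_ : taylor_term j x = fun s => g j x * taylor_time j s); last first.
    by apply/funext => s; rewrite /taylor_term mulrC.
  rewrite (_ : _ - _ = g j x * (if j is k.+1 then taylor_time k t else 0)).
    exact/left_derivativeZ/left_derivative_taylor_time.
  rewrite (_ : \sum_i _ = - taylor_drift j.+1 x t).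
    rewrite opprK subrK /taylor_drift.
    by case: (j) => [|k]; [rewrite mulr0|rewrite mulrC].
  rewrite /= mulr_sumr -sumrN; apply: eq_bigr => i _.
  by have [_ ->] := dt x t i; ring.
Qed.

(** The remainder vanishes at time 0 and solves the transport equation with a
    source equal to the last drift, of size t ^ (p - 1).  The maximum principle
    on [0, t] bounds it by t times this size.  All the higher derivatives fall
    on the data c and u0. *)
Lemma taylor_remainder (T : R) w : 0 <= T ->
  transport_with_source c T w (fun _ _ => 0) -> (forall x, w x 0 = u0 x) ->
  exists2 G, 0 <= G & forall x t, 0 <= t <= T ->
    `|w x t - \sum_(j < p) taylor_term j x t| <= G * t ^+ p.
Proof.
move=> T0 tw w0.
have [G G0 gG] : exists2 G, 0 <= G & forall x, `|g p x| <= G.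
  apply: torus_bounded; last exact: time_derivative0_periodic.
  by apply: Ck_continuous (time_derivative0_Ck (leqnn p)).
exists G => // x t /[dup] tT /andP[t0 tT'].
(* The scalars 1 and -1 and the summand 0 put the remainder in the shape
   produced by the closure lemmas. *)
have tr : transport_with_source c t
    (fun x t => -1 * (\sum_(j < p) 1 * taylor_term j x t) + w x t)
    (fun x t => -1 * (\sum_(j < p)
      1 * (taylor_drift j x t - taylor_drift j.+1 x t)) + 0).
  apply: transport_lin; last first.
    have := @transport_shift _ _ c T t 0 w (fun _ _ => 0) (lexx _).
    rewrite addr0 => /(_ tT' tw).
    rewrite (_ : (fun x t => w x (t + 0)) = w)//.
    by apply/funext => y; apply/funext => s; rewrite addr0.
  apply: transport_sum => j; exact: transport_taylor_term.
have := maximum_principle_norm (A := 0) (M := G * t ^+ p.-1) tr.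
move=> /(_ _ _ x t); rewrite lexx t0 => /(_ _ _ isT).
rewrite mulN1r addrC add0r -mulrA -exprSr prednK//.
under eq_bigr do rewrite mul1r.
apply.
- move=> y s /andP[s0 st].
  under eq_bigr do rewrite mul1r.
  rewrite addr0 mulN1r normrN.
  have -> : \sum_(j < p) (taylor_drift j y s - taylor_drift j.+1 y s) =
      - taylor_drift p y s.
    rewrite -(big_mkord xpredT
      (fun j => taylor_drift j y s - taylor_drift j.+1 y s)).
    have := telescope_sumr (fun j => - taylor_drift j y s) (leq0n p).
    rewrite /= oppr0 subr0 => <-.
    by apply: eq_bigr => j _; rewrite opprK addrC.
  have -> : taylor_drift p y s = taylor_time p.-1 s * g p y.
    by rewrite -[in LHS](prednK p0) taylor_driftS prednK.
  rewrite normrN normrM mulrC ler_pM// /taylor_time.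
  rewrite normrM normfV normr_nat normrX (gtr0_norm s0).
  rewrite ler_pdivrMr ?ltr0n ?fact_gt0//.
  apply: le_trans (_ : t ^+ p.-1 <= _).
    by rewrite lerXn2r// nnegrE ltW.
  by rewrite ler_peMr ?exprn_ge0// ler1n fact_gt0.
- move=> y; under eq_bigr do rewrite mul1r.
  rewrite w0 mulN1r -(prednK p0) big_ord_recl big1 => [|j _].
    rewrite addr0 /taylor_term /taylor_time expr0 fact0 divr1 mul1r.
    by rewrite addNr normr0.
  by rewrite /taylor_term /taylor_time expr0n/= !mul0r.
Qed.

(** At fixed x the Taylor polynomial has degree less than p in the time, so that
    interpolation reproduces it; only the remainders at times at most h
    contribute to the error. *)
Lemma interpolation_error_at0 (T : R) w (a : 'I_p -> R -> R) (K : R) : 0 <= T ->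
  transport_with_source c T w (fun _ _ => 0) -> (forall x, w x 0 = u0 x) ->
  (forall i s, 0 <= s <= 1 -> `|a i s| <= K) ->
  (forall (q : {poly R}) s, (size q <= p)%N ->
      q.[s] = \sum_i a i s * q.[i%:R / p%:R]) ->
  exists2 C, 0 <= C & forall x h s, 0 <= h <= T -> 0 <= s <= 1 ->
    `|w x (s * h) - \sum_i a i s * w x (i%:R / p%:R * h)| <= C * h ^+ p.
Proof.
move=> T0 tw w0 aK aq.
have [G G0 Gw] := taylor_remainder T0 tw w0.
exists (G + \sum_(i < p) K * G).
  have K0 : 0 <= K.
    have := aK (Ordinal p0) 0; rewrite lexx ler01 => /(_ isT).
    exact: le_trans.
  by rewrite addr_ge0// sumr_ge0// => i _; exact: mulr_ge0.
move=> x h s /andP[h0 hT] s01.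
pose r t := w x t - \sum_(j < p) taylor_term j x t.
have rG t : 0 <= t <= 1 -> `|r (t * h)| <= G * h ^+ p.
  move=> /andP[t0 t1].
  have th : t * h <= h by rewrite ler_piMl.
  apply: le_trans (Gw x (t * h) _) _.
    by rewrite mulr_ge0//= (le_trans th).
  by rewrite ler_wpM2l// lerXn2r// nnegrE mulr_ge0.
pose q : {poly R} := \poly_(j < p) (taylor_time j h * g j x).
have qE t : q.[t] = \sum_(j < p) taylor_term j x (t * h).
  rewrite horner_poly; apply: eq_bigr => j _.
  by rewrite /taylor_term /taylor_time exprMn; ring.
have -> : w x (s * h) - \sum_i a i s * w x (i%:R / p%:R * h) =
    r (s * h) - \sum_i a i s * r (i%:R / p%:R * h).
  rewrite /r -qE (aq q s (size_poly _ _)) -addrA -opprD; congr (_ - _).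
  rewrite -big_split/=; apply: eq_bigr => i _.
  by rewrite -qE mulrBr addrC subrK.
apply: le_trans (ler_normB _ _) _; rewrite mulrDl lerD//; first exact: rG.
apply: le_trans (ler_norm_sum _ _ _) _.
rewrite mulr_suml; apply: ler_sum => i _.
rewrite normrM -[leRHS]mulrA ler_pM//; first exact: aK.
apply: rG; rewrite divr_ge0//= ler_pdivrMr ?ltr0n// mul1r ler_nat.
exact/ltnW.
Qed.

End taylor.

(** For fixed s the interpolation error, as a function of x and of the base time
    t, is a combination of translates of the solution and so solves the same
    homogeneous equation.  By the maximum principle its supremum over x is
    largest at t = 0, where the Taylor estimate applies. *)
Lemma snapshot_interpolation (R : realType) (d p : nat) (T : R)
    (c : 'rV[R]_d -> 'rV[R]_d) (u0 : 'rV[R]_d -> R) w :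
  (0 < p)%N -> torus_Ck_field p c -> torus_Ck p u0 -> 0 <= T ->
  transport_with_source c T w (fun _ _ => 0) -> (forall x, w x 0 = u0 x) ->
  exists (a : 'I_p -> R -> R) (C : R), 0 <= C /\
    forall x t h s, 0 <= t -> 0 <= h -> t + h <= T -> 0 <= s <= 1 ->
    `|w x (t + s * h) - \sum_i a i s * w x (t + i%:R / p%:R * h)| <= C * h ^+ p.
Proof.
move=> p0 hc hu0 T0 tw w0.
have [a [K [K0 aK aq]]] := interpolation_weights (R := R) p0.
have [C C0 Cw] := interpolation_error_at0 p0 hc hu0 T0 tw w0 aK aq.
exists a, C; split => // x t h s t0 h0 thT s01.
have hT : h <= T by rewrite (le_trans _ thT)// lerDr.
have shift r : 0 <= r <= 1 ->
    transport_with_source c (T - h) (fun x t => w x (t + r * h)) (fun _ _ => 0).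
  move=> /andP[r0 r1]; apply: transport_shift tw; first exact: mulr_ge0.
  have : r * h <= h by rewrite ler_piMl.
  lra.
have node01 (i : 'I_p) : 0 <= (i%:R / p%:R : R) <= 1.
  rewrite divr_ge0//= ler_pdivrMr ?ltr0n// mul1r ler_nat; exact/ltnW.
have tv := transport_lin (-1) (transport_sum (index_enum 'I_p) (a ^~ s)
  (fun i => shift _ (node01 i))) (shift s s01).
have t_itv : 0 <= t <= T - h by rewrite t0 lerBrDr.
rewrite (_ : C * h ^+ p = C * h ^+ p + 0 * t); last by rewrite mul0r addr0.
rewrite addrC -mulN1r; apply: (maximum_principle_norm tv) => // [y r _|y].
  by rewrite big1 ?mulr0 ?addr0 ?normr0// => i _; rewrite mulr0.
rewrite mulN1r addrC add0r; under eq_bigr do rewrite add0r.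
by apply: Cw => //; rewrite h0.
Qed.

(** * Finite spans in a semi-inner-product space *)

Section semi_inner_product.
Context {R : realType} {E : lmodType R}.
Variable B : E -> E -> R.
Hypothesis BC : forall f g, B f g = B g f.
Hypothesis Blin : forall a f g h, B (a *: f + g) h = a * B f h + B g h.
Hypothesis B_ge0 : forall f, 0 <= B f f.

Let B0l h : B 0 h = 0.
Proof.
have := Blin 1 0 0 h; rewrite scaler0 addr0 mul1r => /eqP.
by rewrite -subr_eq0 opprD addrA subrr sub0r oppr_eq0 => /eqP.
Qed.

Let BDl f g h : B (f + g) h = B f h + B g h.
Proof. by rewrite -[f in LHS]scale1r Blin mul1r. Qed.

Let BZl a f h : B (a *: f) h = a * B f h.
Proof. by rewrite -[a *: f]addr0 Blin B0l addr0. Qed.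

Let BBl f g h : B (f - g) h = B f h - B g h.
Proof. by rewrite BDl -scaleN1r BZl mulN1r. Qed.

Let BDr f g h : B f (g + h) = B f g + B f h.
Proof. by rewrite BC BDl !(BC f). Qed.

Let BZr a f h : B f (a *: h) = a * B f h.
Proof. by rewrite BC BZl (BC f). Qed.

(** Since B r r = 0, the square B g g of g = t r + f is affine in t; it can
    stay nonnegative only if its slope 2 B f r vanishes. *)
Lemma semi_inner_degenerate f r : B r r = 0 -> B f r = 0.
Proof.
move=> r0; apply/eqP/negPn/negP => fr0.
pose t := - (B f f + 1) / (2 * B f r).
have := B_ge0 (t *: r + f).
rewrite BDr !BDl !BZr !BZl r0 (BC r) !mulr0 add0r.
have -> : t * B f r + (t * B f r + B f f) = -1.
  rewrite /t; field; exact: fr0.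
by rewrite lerNr oppr0 ler10.
Qed.

Definition combination n (b : 'I_n -> E) (a : 'I_n -> R) : E :=
  \sum_i a i *: b i.

Lemma combination_lin n (b : 'I_n -> E) k a1 a2 :
  combination b (fun i => k * a1 i + a2 i) =
  k *: combination b a1 + combination b a2.
Proof.
rewrite /combination scaler_sumr -big_split/=; apply: eq_bigr => i _.
by rewrite scalerDl scalerA.
Qed.

Lemma orthogonal_combination n (b : 'I_n -> E) a f :
  (forall i, B f (b i) = 0) -> B f (combination b a) = 0.
Proof.
move=> fb; rewrite /combination; elim/big_rec : _ => [|i g _ IH].
  by rewrite BC B0l.
by rewrite BDr BZr fb mulr0 add0r.
Qed.

(** Gram-Schmidt for a possibly dependent family: the new vector is first
    made orthogonal to the previous ones, and if what remains has norm zero then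
    it is orthogonal to everything and needs no correction. *)
Lemma orthogonal_projection n (b : 'I_n -> E) f :
  exists a, forall i, B (f - combination b a) (b i) = 0.
Proof.
elim: n b f => [|n IH] b f; first by exists (fun=> 0); case.
pose b' i := b (lift ord_max i); pose e := b ord_max.
have extend a' k : combination b
    (fun i => oapp a' k (unlift ord_max i)) = combination b' a' + k *: e.
  rewrite /combination (bigD1_ord ord_max)//= unlift_none/= addrC.
  congr (_ + _).
  by apply: eq_bigr => i _; rewrite liftK.
have [a1 a1E] := IH b' e; have [a2 a2E] := IH b' f.
pose r := e - combination b' a1.
have rb' a : B r (combination b' a) = 0 by exact: orthogonal_combination.
pose k := B f r / B r r.
(* When B r r = 0, division by zero gives k = 0, which is the right value. *)
exists (fun i => oapp (fun j => (- k) * a1 j + a2 j) k (unlift ord_max i)).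
rewrite extend combination_lin.
have -> : f - (- k *: combination b' a1 + combination b' a2 + k *: e) =
    f - combination b' a2 - k *: r.
  rewrite /r scalerBr scaleNr !opprD !opprK -!addrA; congr (_ + _).
  by rewrite addrC -addrA.
have ortho_b' j : B (f - combination b' a2 - k *: r) (b' j) = 0.
  by rewrite BBl a2E BZl a1E mulr0 subr0.
have ortho_r : B (f - combination b' a2 - k *: r) r = 0.
  rewrite !BBl BZl (BC (combination b' a2)) rb' subr0.
  have [r0|r0] := eqVneq (B r r) 0.
    by rewrite r0 mulr0 subr0; exact: semi_inner_degenerate.
  by rewrite /k divfK// subrr.
move=> i; case: (unliftP ord_max i) => [j ->|->]; first exact: ortho_b'.
rewrite -/e (_ : e = r + combination b' a1); last by rewrite /r subrK.
by rewrite BDr ortho_r add0r orthogonal_combination.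
Qed.

Lemma projection_minimizes f g h :
  B (f - g) (g - h) = 0 -> B (f - g) (f - g) <= B (f - h) (f - h).
Proof.
move=> fgh.
have -> : f - h = (f - g) + (g - h) by rewrite addrA subrK.
move: (f - g) (g - h) fgh => u v uv.
rewrite BDr !BDl uv (BC v) uv addr0 add0r.
by rewrite lerDl.
Qed.

End semi_inner_product.

Section basis_modulo.
Context {R : realType} {E : lmodType R}.
Variable N : E -> Prop.
Hypothesis Nlin : forall a f g, N f -> N g -> N (a *: f + g).

(** The span in the quotient of E by the subspace N. *)
Definition span_mod n (b : 'I_n -> E) (f : E) : Prop :=
  exists a, N (f - combination b a).

(** As long as there is a nontrivial relation modulo N, one vector with a
    nonzero coefficient is discarded; the others still span. *)
Lemma basis_of_span_mod m (s : 'I_m -> E) : exists n (b : 'I_n -> E),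
  [/\ (n <= m)%N, forall f, span_mod b f <-> span_mod s f &
      forall a, N (combination b a) -> forall i, a i = 0].
Proof.
elim: m s => [|m IH] s.
  by exists 0%N, s; split => // a _ [].
have [free|] := pselect (forall a, N (combination s a) -> forall i, a i = 0).
  by exists m.+1, s.
move=> /existsNP[a /not_implyP[Na /existsNP[i0 /eqP ai0]]].
pose s' j := s (lift i0 j).
have [n [b [nm bs' freeb]]] := IH s'.
exists n, b; split => //; first exact: leqW.
move=> f; rewrite bs'; split=> -[e Ne].
  exists (fun i => oapp e 0 (unlift i0 i)).
  rewrite (_ : combination s _ = combination s' e)//.
  rewrite /combination (bigD1_ord i0)//= unlift_none/= scale0r add0r.
  by apply: eq_bigr => j _; rewrite liftK.
pose k := e i0 / a i0.
exists (fun j => (- k) * a (lift i0 j) + e (lift i0 j)).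
rewrite (_ : _ - _ = k *: combination s a + (f - combination s e)).
  exact: Nlin.
have splits e' : combination s e' = e' i0 *: s i0 +
    combination s' (fun j => e' (lift i0 j)).
  by rewrite /combination (bigD1_ord i0).
rewrite combination_lin !splits scalerDr scalerA /k divfK// -/k scaleNr.
rewrite !opprD opprK [RHS]addrCA; congr (_ + _).
by rewrite addrACA subrr add0r.
Qed.

End basis_modulo.

(** * Measurability and the inner product of L^2 *)

Section continuous_measurable.
Context {R : realType} {d : nat}.

(** This rounding takes countably many values, each on a box, so that any
    function composed with it is measurable. *)
Definition grid_round (n : nat) (x : 'rV[R]_d) : 'rV[R]_d :=
  \row_i ((Num.floor (n.+1%:R * x ord0 i))%:~R / n.+1%:R).

Lemma grid_round_cvg (x : 'rV[R]_d) : grid_round n x @[n --> \oo] --> x.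
Proof.
have cv (j : 'I_d) : grid_round n x ord0 j @[n --> \oo] --> x ord0 j.
  apply/cvgrPdist_le => e e0; near=> n.
  have n0 : 0 < n.+1%:R :> R by rewrite ltr0n.
  have ne : n.+1%:R^-1 < e.
    by near: n; exact: (near_infty_natSinv_lt (PosNum e0)).
  apply: le_trans (ltW ne); rewrite mxE.
  rewrite -(@ler_pM2l _ n.+1%:R)// divff ?gt_eqF//.
  rewrite -{1}(gtr0_norm n0) -normrM mulrBr mulrCA divff ?gt_eqF// mulr1.
  have /andP[f1 f2] := floor_itv (n.+1%:R * x ord0 j).
  rewrite ger0_norm ?subr_ge0// lerBlDl.
  by have := ltW f2; rewrite intrD.
move=> A [P Px PA]; rewrite /nbhs/=.
have : \forall n \near \oo, forall j : 'I_d, P ord0 j (grid_round n x ord0 j).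
  by apply: filter_forall => j; apply: cv; exact: Px.
apply: filterS => n Pn; apply: PA => i j /=; rewrite ord1; exact: Pn.
Unshelve. all: by end_near. Qed.

Lemma measurable_grid_round (f : 'rV[R]_d -> R) n :
  measurable_fun [set: 'rV[R]_d] (f \o grid_round n).
Proof.
move=> _ Y mY; rewrite setTI.
have n0 : 0 < n.+1%:R :> R by rewrite ltr0n.
pose cell (k : 'rV[int]_d) := [set x : 'rV[R]_d | forall i,
  x ord0 i \in `[(k ord0 i)%:~R / n.+1%:R, (k ord0 i + 1)%:~R / n.+1%:R[].
have cellP k x : cell k x <-> k = \row_i Num.floor (n.+1%:R * x ord0 i).
  split=> [kx|-> i].
    apply/rowP => i; rewrite mxE; apply/esym/floor_def.
    have := kx i; rewrite in_itv/= ler_pdivrMr// ltr_pdivlMr//.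
    by rewrite ![_ * n.+1%:R]mulrC.
  rewrite in_itv/= mxE ler_pdivrMr// ltr_pdivlMr// ![_ * n.+1%:R]mulrC.
  exact: floor_itv.
rewrite (_ : _ @^-1` Y = \bigcup_(k in [set k : 'rV[int]_d |
    Y (f (\row_i ((k ord0 i)%:~R / n.+1%:R)))]) cell k); last first.
  apply/seteqP; split => [x /= Yx|x [k /= Yk /cellP kx]].
    exists (\row_i Num.floor (n.+1%:R * x ord0 i)); last exact/cellP.
    by rewrite /=; under eq_mx do rewrite mxE.
  by move: Yk; rewrite kx; under eq_mx do rewrite mxE.
rewrite bigcup_mkcond; apply: countable_bigcupT_measurable.
  exact: countableP.
move=> k; case: ifP => // _.
exact: (@measurable_rV_box R d (fun i =>
  [set` `[(k ord0 i)%:~R / n.+1%:R, (k ord0 i + 1)%:~R / n.+1%:R[])).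
Qed.

(** The sigma-algebra is the one generated by the coordinates, so Borel sets are
    not measurable by definition; a continuous f is the pointwise limit of its
    compositions with the grid roundings. *)
Lemma continuous_measurable_rV (f : 'rV[R]_d -> R) :
  continuous f -> measurable_fun [set: 'rV[R]_d] f.
Proof.
move=> cf; apply: (measurable_fun_cvg (h := fun n => f \o grid_round n)).
  by move=> n; exact: measurable_grid_round.
by move=> x _; apply: continuous_cvg; [exact: cf|exact: grid_round_cvg].
Qed.

End continuous_measurable.

Section torus_L2.
Context {R : realType} {d : nat}.
Local Notation mu := (@torus_measure R d).
Implicit Types f g h : L2 R d.

Lemma torus_measureT : mu setT = ((2 * pi) ^+ d)%:E.
Proof.
rewrite /torus_measure/= /mrestr setTI.
rewrite (@lebesgue_rV_box R d (fun=> [set` `[0, 2 * pi]]))//.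
rewrite (eq_bigr (fun=> (2 * pi)%:E)) => [|i _].
  by rewrite prodEFin prodr_const card_ord.
rewrite lebesgue_measure_itv/= lte_fin ifT ?sube0//.
by rewrite mulr_gt0// pi_gt0.
Qed.

Definition L2_inner f g : R := \int[mu]_x (f x * g x).

Lemma L2_integrableM f g : mu.-integrable setT (EFin \o (fun x => f x * g x)).
Proof. by apply/Lfun1_integrable; apply: Lfun2_mul_Lfun1; exact: LfunP. Qed.

Lemma L2_innerC f g : L2_inner f g = L2_inner g f.
Proof. by apply: eq_Rintegral => x _; rewrite mulrC. Qed.

Lemma L2_inner_lin a f g h :
  L2_inner (a *: f + g) h = a * L2_inner f h + L2_inner g h.
Proof.
rewrite /L2_inner -RintegralZl//; last exact: L2_integrableM.
rewrite -RintegralD//.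
- by apply: eq_Rintegral => x _ /=; rewrite mulrDl mulrA.
- rewrite (_ : EFin \o _ = EFin \o (fun x => (a *: f) x * h x)).
    exact: L2_integrableM.
  by apply/funext => x /=; rewrite mulrA.
- exact: L2_integrableM.
Qed.

Lemma L2_inner_ge0 f : 0 <= L2_inner f f.
Proof. by apply: Rintegral_ge0 => x _; rewrite -expr2 sqr_ge0. Qed.

Lemma L2_norm_sqr f : (L2_norm f `^ 2 = (L2_inner f f)%:E)%E.
Proof.
rewrite /L2_norm powR_Lnorm//.
rewrite /L2_inner /Rintegral fineK; last first.
  by apply: integrable_fin_num => //; exact: L2_integrableM.
apply: eq_integral => x _ /=.
by rewrite powR_mulrn// -normrX ger0_norm ?sqr_ge0 ?expr2.
Qed.

Lemma L2_inner_le f (K : R) : (forall x, `|f x| <= K) ->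
  L2_inner f f <= K ^+ 2 * (2 * pi) ^+ d.
Proof.
move=> fK.
have -> : K ^+ 2 * (2 * pi) ^+ d = \int[mu]_(x in setT) (K ^+ 2).
  by rewrite Rintegral_cst// torus_measureT.
apply: le_Rintegral => //; first exact: L2_integrableM.
  apply/integrableP; split; first exact: measurable_cst.
  by rewrite integral_cst// torus_measureT ltry.
move=> x _; rewrite -expr2 -real_normK ?num_real//.
by rewrite lerXn2r ?nnegrE ?(le_trans _ (fK x)).
Qed.

Lemma bounded_L2 (f : 'rV[R]_d -> R) (K : R) :
  continuous f -> (forall x, `|f x| <= K) ->
  exists g : L2 R d, g = f :> (_ -> _).
Proof.
move=> cf fK.
have fL : f \in Lfun mu 2%:E.
  apply/andP; split; first by apply/mem_set; exact: continuous_measurable_rV.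
  apply/mem_set; rewrite /= /finite_norm.
  rewrite unlock /Lnorm; apply: poweR_lty.
  apply: (@le_lt_trans _ _ (\int[mu]_(x in setT) (K ^+ 2)%:E)%E).
    apply: ge0_le_integral => //.
    - by move=> x _; rewrite lee_fin.
    - apply/measurable_EFinP.
      apply: (@measurableT_comp _ _ _ _ _ _ (fun x : R => x `^ 2)).
        exact: measurable_powR.
      by apply: measurableT_comp => //; exact: continuous_measurable_rV.
    - move=> x _ /=; rewrite lee_fin powR_mulrn// lerXn2r// nnegrE.
      exact: le_trans (fK x).
  by rewrite integral_cst// torus_measureT ltry.
by exists (Lfun_Sub (lee1n 2) fL).
Qed.

End torus_L2.

(** * Spans in L^2 and the rate of convergence *)

Section L2_span.
Context {R : realType} {d : nat}.
Local Notation mu := (@torus_measure R d).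
Implicit Types f g h : L2 R d.

Definition L2_null f : Prop := f = 0 %[ae mu].

Lemma L2_nullP f g : L2_null (f - g) <-> f = g %[ae mu].
Proof.
split; apply: filterS => x /(_ Logic.I) fg _ /=.
  by apply/eqP; rewrite -subr_eq0; apply/eqP.
by apply/eqP; rewrite subr_eq0; apply/eqP.
Qed.

Lemma L2_null0 : L2_null 0.
Proof. by apply: nearW. Qed.

Lemma L2_null_lin a f g : L2_null f -> L2_null g -> L2_null (a *: f + g).
Proof.
apply: filterS2 => x /(_ Logic.I) f0 /(_ Logic.I) g0 _ /=.
by rewrite -[LHS]/(a * f x + g x) f0 g0 addr0 mulr0.
Qed.

Lemma L2_inner_null f g : L2_null g -> L2_inner f g = 0.
Proof.
move=> g0; rewrite /L2_inner /Rintegral.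
rewrite (@ae_eq_integral _ _ _ mu setT (cst 0%E))//.
- by rewrite integral_cst// mul0e.
- by have /integrableP[] := L2_integrableM f g.
- by apply: filterS g0 => x /(_ Logic.I) g0 _ /=; rewrite g0 mulr0.
Qed.

Definition L2_span m (s : 'I_m -> L2 R d) : set (L2 R d) := span_mod L2_null s.

Lemma L2_span_subspace m (s : 'I_m -> L2 R d) : L2_subspace (L2_span s).
Proof.
split.
- exists (fun=> 0); rewrite /combination big1 ?subrr; first exact: L2_null0.
  by move=> i _; rewrite scale0r.
- move=> a f g [e ef] [e' eg]; exists (fun i => a * e i + e' i).
  rewrite combination_lin (_ : _ - _ =
    a *: (f - combination s e) + (g - combination s e')).
    exact: L2_null_lin.
  by rewrite scalerBr opprD addrACA.
- move=> f g [e ef] /L2_nullP fg; exists e.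
  rewrite (_ : _ - _ = (-1) *: (f - g) + (f - combination s e)).
    exact: L2_null_lin.
  by rewrite scaleN1r opprB addrA subrK.
Qed.

Lemma L2_span_dim m (s : 'I_m -> L2 R d) :
  exists2 n, (n <= m)%N & L2_dim (L2_span s) n.
Proof.
have [n [b [nm bs freeb]]] := basis_of_span_mod L2_null_lin s.
exists n => //; exists b; split=> [i|a b0|f /bs[a ab]].
- apply/bs; exists (fun j => (j == i)%:R).
  rewrite /combination (bigD1 i)//= eqxx scale1r big1 ?addr0 ?subrr.
    exact: L2_null0.
  by move=> j /negbTE ->; rewrite scale0r.
- by apply: freeb.
- by exists a; apply/L2_nullP.
Qed.

(** The projection is characterised by orthogonality, so it is at least as close
    to f as any combination of s.  That such a projection exists has to be shown
    first, for otherwise [L2_proj] would be its default value 0. *)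
Lemma L2_proj_span_le m (s : 'I_m -> L2 R d) f a :
  (L2_norm (fun x => L2_proj (L2_span s) f x - f x)%R `^ 2 <=
   (L2_inner (f - combination s a)%R (f - combination s a)%R)%:E)%E.
Proof.
have innerC := @L2_innerC R d; have innerL := @L2_inner_lin R d.
have inner_ge0 := @L2_inner_ge0 R d.
set P := L2_proj _ _.
have [Ps Portho] : L2_span s P /\
    forall h, L2_span s h -> L2_inner (f - P) h = 0.
  apply: (@xgetPex _ 0 [set g : L2 R d | L2_span s g /\ forall h : L2 R d,
    L2_span s h -> \int[mu]_x ((f x - g x) * h x) = 0]).
  have [e eE] := orthogonal_projection innerC innerL inner_ge0 s f.
  exists (combination s e); split.
    by exists e; rewrite subrr; exact: L2_null0.
  move=> h [e' he']; rewrite -[LHS]/(L2_inner (f - combination s e) h).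
  rewrite -(subrK (combination s e') h) innerC -[h - _]scale1r innerL.
  rewrite innerC L2_inner_null// mulr0 add0r innerC.
  exact: orthogonal_combination.
have -> : L2_norm (fun x => P x - f x) = L2_norm (P - f : L2 R d) by [].
rewrite L2_norm_sqr lee_fin.
have -> : L2_inner (P - f) (P - f) = L2_inner (f - P) (f - P).
  by apply: eq_Rintegral => x _ /=; rewrite -mulrNN !opprB.
apply: projection_minimizes => //; apply: Portho.
have [_ lin _] := L2_span_subspace s.
rewrite addrC -scaleN1r; apply: lin => //.
by exists a; rewrite subrr; exact: L2_null0.
Qed.

End L2_span.

Section integral_upper_bound.
Import HBNNSimple.

(** The integral of a nonnegative function is the supremum of the integrals of
    the simple functions below it, so the bound holds for an arbitrary f.  This
    spares a proof that the projection error depends measurably on the time. *)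
Lemma ge0_integral_le_cst d (T : measurableType d) (R : realType)
    (mu : {measure set T -> \bar R}) (D : set T) (f : T -> \bar R) (M : R) :
  measurable D -> (forall x, D x -> (0 <= f x <= M%:E)%E) ->
  (\int[mu]_(x in D) f x <= M%:E * mu D)%E.
Proof.
move=> mD fM; rewrite ge0_integralE; last by move=> x /fM/andP[].
apply: ge_ereal_sup => _ [h hf <-].
rewrite -integralT_nnsfun -integral_cst// [leRHS]integral_mkcond.
apply: ge0_le_integral => //.
- by move=> x _; rewrite lee_fin; exact: fun_ge0.
- exact/measurable_EFinP.
- by apply/(measurable_restrictT _ _).1 => //; exact: measurable_cst.
- move=> x _; apply: le_trans (hf x) _; rewrite !patchE.
  by case: ifPn => // /set_mem /fM /andP[].
Qed.

End integral_upper_bound.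

Section rate.
Context {R : realType}.

Lemma unit_cell (N : nat) (r : R) : 0 <= r <= N.+1%:R ->
  exists2 k : nat, (k <= N)%N & 0 <= r - k%:R <= 1.
Proof.
elim: N => [|N IH] /andP[r0 rN]; first by exists 0%N => //; rewrite subr0 r0.
have [rN'|Nr] := leP r N.+1%:R.
  by have [|k kN rk] := IH _; [rewrite r0|exists k => //; exact: leqW].
exists N.+1 => //; rewrite subr_ge0 ltW//= lerBlDr.
by rewrite nat1r.
Qed.

(** With y = e ^ (-1/p) the bound is of order y, the comparison function is
    y ^ 2, and y tends to infinity. *)
Lemma little_o_rate (p : nat) (A : R) (n : R -> nat) : (0 < p)%N -> 0 <= A ->
  (forall e, 0 < e -> (n e <= (Num.truncn (A * e `^ (- p%:R^-1))).+1 * p)%N) ->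
  (fun e => (n e)%:R : R) =o_ (0^'+) (fun e => e `^ (- (2 / p%:R)) : R).
Proof.
move=> p0 A0 nA; apply/eqoP => r r0.
have p0' : 0 < p%:R :> R by rewrite ltr0n.
(* The conclusion holds as soon as y >= B, that is, e <= B ^ (- p). *)
pose B := 1 + (A + 1) * p%:R / r.
have B1 : 1 <= B by rewrite lerDl !mulr_ge0 ?invr_ge0 ?addr_ge0 ?(ltW r0).
have B0 : 0 < B by exact: lt_le_trans B1.
near=> e.
have e0 : 0 < e by [].
have eB : e <= B ^- p.
  by near: e; apply: nbhs_right_le; rewrite invr_gt0 exprn_gt0.
pose y := e `^ (- p%:R^-1).
have yB : B <= y.
  rewrite /y powRN -[B]invrK lef_pV2 ?posrE ?powR_gt0// ?invr_gt0//.
  have -> : B^-1 = (B ^- p) `^ (p%:R^-1).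
    rewrite -exprVn -powR_mulrn ?invr_ge0 ?(ltW B0)// -powRrM.
    by rewrite divff ?gt_eqF// powRr1 ?invr_ge0 ?(ltW B0).
  apply: ge0_ler_powR => //;
    by rewrite ?nnegrE ?invr_ge0 ?exprn_ge0 ?(ltW e0) ?(ltW B0).
have y1 : 1 <= y by exact: le_trans yB.
have y0 : 0 < y by exact: lt_le_trans y1.
have -> : e `^ (- (2 / p%:R)) = y * y.
  rewrite /y -powRD; last by rewrite (gt_eqF e0) implybT.
  by congr (_ `^ _); field; rewrite gt_eqF.
rewrite ger0_norm// ger0_norm ?mulr_ge0 ?(ltW y0)//.
apply: (@le_trans _ _ ((A * y + 1) * p%:R)).
  have := nA e e0; rewrite -(ler_nat R) natrM => /le_trans; apply.
  rewrite ler_pM2r// -natr1 lerD2r.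
  by rewrite truncn_le// mulr_ge0 ?(ltW y0).
apply: (@le_trans _ _ ((A + 1) * p%:R * y)).
  rewrite mulrAC ler_pM2r// mulrDl lerD2l mul1r//.
rewrite mulrA ler_pM2r//.
by rewrite -ler_pdivrMl// mulrC; apply: le_trans yB; rewrite lerDr.
Unshelve. all: by end_near. Qed.

End rate.

(** * Snapshots *)

Section rate_of_snapshots.
Context {R : realType} {d : nat}.

Lemma L2_sumE (I : Type) (r : seq I) (a : I -> R) (F : I -> L2 R d) x :
  (\sum_(i <- r) a i *: F i) x = \sum_(i <- r) a i * F i x.
Proof.
elim: r => [|i r IH]; first by rewrite !big_nil.
by rewrite !big_cons -IH.
Qed.

(** The space is spanned by the snapshots of u at the times m T / ((N + 1) p).
    The time interval is cut into N + 1 cells of length h, each containing p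
    consecutive snapshot times, and in the cell of t the snapshots are combined
    with the interpolation weights.  The resulting pointwise error C h ^ p also
    bounds the error of the orthogonal projection. *)
Lemma snapshot_space (T : R) (p : nat) (c : 'rV[R]_d -> 'rV[R]_d)
    (u0 : 'rV[R]_d -> R) (u : 'rV[R]_d -> R -> R) :
  0 < T -> (0 < p)%N -> torus_Ck_field p c -> torus_Ck p u0 ->
  transport_solution T c u0 u ->
  exists2 K : R, 0 <= K & forall N, exists (V : set (L2 R d)) (n : nat),
    [/\ L2_subspace V, L2_dim V n, (n <= N.+1 * p)%N &
    forall t, 0 <= t <= T ->
      (L2_norm (fun x => L2_proj V (u ^~ t) x - u x t)%R `^ 2 <=
       (K / N.+1%:R ^+ p.*2)%:E)%E].
Proof.
move=> T0 p0 hc hu0 hu.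
have tw := transport_solution_clamp T0 hu.
set w := (fun x t => u x (clamp T t)) in tw.
have wE x t : 0 <= t <= T -> w x t = u x t by move=> tT; rewrite /w clampE.
have w0 x : w x 0 = u0 x by case: hu => _ _ _ <-; rewrite wE// lexx ltW.
have [a [C [C0 Cw]]] := snapshot_interpolation p0 hc hu0 (ltW T0) tw w0.
(* Outside [0, T] any element will do, which makes the choice total. *)
have snapL t : exists g : L2 R d, 0 <= t <= T -> g = w ^~ t :> (_ -> _).
  have [tT|tT] := boolP (0 <= t <= T); last by exists 0.
  have [cw pw _ _] := tw.
  have cwt : continuous (w ^~ t).
    move=> x; apply: (@continuous_comp _ _ _ (fun x : 'rV[R]_d => (x, t))
      (fun z => w z.1 z.2)); last exact: cw.
    apply: (@cvg_pair _ _ _ (nbhs x) (nbhs x) (nbhs t)); first exact: cvg_id.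
    exact: cvg_cst.
  have [M _ wM] := torus_bounded cwt (pw t tT).
  by have [g gE] := bounded_L2 cwt wM; exists g.
have {snapL}[snap snapE] := choice snapL.
exists ((C * T ^+ p) ^+ 2 * (2 * pi) ^+ d).
  by rewrite mulr_ge0 ?sqr_ge0// exprn_ge0// mulr_ge0// pi_ge0.
move=> N; pose h := T / N.+1%:R.
have h0 : 0 < h by rewrite divr_gt0.
have hN : N.+1%:R * h = T by rewrite /h mulrC divfK// pnatr_eq0.
pose s (m : 'I_(N.+1 * p)) := snap (m%:R / p%:R * h).
have [n nm dimV] := L2_span_dim s.
exists (L2_span s), n; split => //; first exact: L2_span_subspace.
move=> t /[dup] tT /andP[t0 tT'].
have [|k kN] := @unit_cell R N (t / h).
  by rewrite divr_ge0 ?(ltW h0)//= ler_pdivrMr// hN.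
set r := t / h - k%:R => r01.
have tE : t = k%:R * h + r * h by rewrite -mulrDl /r addrC subrK divfK ?gt_eqF.
have khT : k%:R * h + h <= T.
  by rewrite -{2}[h]mul1r -mulrDl natr1 -hN ler_pM2r// ler_nat.
have kp (i : 'I_p) : (k * p + i < N.+1 * p)%N.
  rewrite (@leq_trans (k.+1 * p))%N// ?leq_mul2r ?ltnS ?kN ?orbT//.
  by rewrite mulSn addnC ltn_add2r.
(* The weights of the p snapshots of the k-th cell, extended by zero. *)
pose e (m : 'I_(N.+1 * p)) : R := \sum_(i < p) (m == Ordinal (kp i))%:R * a i r.
have eE : combination s e = \sum_(i < p) a i r *: s (Ordinal (kp i)).
  rewrite /combination /e; under eq_bigr do rewrite scaler_suml.
  rewrite exchange_big/=; apply: eq_bigr => i _.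
  rewrite (bigD1 (Ordinal (kp i)))//= eqxx mul1r big1 ?addr0// => m /negbTE ->.
  by rewrite mul0r scale0r.
have sE i x : s (Ordinal (kp i)) x = w x (k%:R * h + i%:R / p%:R * h).
  have p0' : p%:R != 0 :> R by rewrite pnatr_eq0 -lt0n.
  rewrite /s /= natrD natrM snapE.
    by congr w; field.
  rewrite -natrM -natrD; apply/andP; split; first exact/mulr_ge0/ltW.
  rewrite -hN ler_pM2r// ler_pdivrMr ?ltr0n// -natrM ler_nat; exact/ltnW/kp.
have utE : (u ^~ t) = snap t.
  by apply/funext => y; rewrite snapE// wE.
have -> : L2_norm (fun x => L2_proj (L2_span s) (u ^~ t) x - u x t) =
    L2_norm (fun x => L2_proj (L2_span s) (snap t) x - snap t x).
  by rewrite -utE.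
apply: le_trans (L2_proj_span_le s (snap t) e) _; rewrite lee_fin.
apply: le_trans (L2_inner_le (K := C * h ^+ p) _) _.
  move=> x; rewrite -[X in `|X|]/(snap t x - combination s e x).
  have -> : combination s e x = \sum_(i < p) a i r * s (Ordinal (kp i)) x.
    by rewrite eE L2_sumE.
  rewrite snapE// {1}tE; under eq_bigr do rewrite sE.
  by apply: Cw => //; [exact/mulr_ge0/ltW|exact: ltW].
rewrite [leRHS]mulrAC ler_wpM2r ?exprn_ge0 ?mulr_ge0 ?pi_ge0//.
by rewrite /h expr_div_n mulrA expr_div_n -exprM muln2.
Qed.

End rate_of_snapshots.

Theorem lemma2p11 (R : realType) (d : nat) (hd : (1 <= d)%N) (T : R)
    (hT : 0 < T) (p : nat) (hp : (1 <= p)%N)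
    (c : 'rV[R]_d -> 'rV[R]_d) (u0 : 'rV[R]_d -> R) (u : 'rV[R]_d -> R -> R)
    (hc : torus_Ck_field p c) (hu0 : torus_Ck p u0)
    (hu : transport_solution T c u0 u) :
  exists (V : R -> set (L2 R d)) (n : R -> nat),
    (forall eps : R, 0 < eps ->
      [/\ L2_subspace (V eps), L2_dim (V eps) (n eps) &
          ((\int[lebesgue_measure]_(t in `[0%R, T])
              (L2_norm (fun x => L2_proj (V eps) (u ^~ t) x - u x t)%R `^ 2))
            `^ 2^-1 <= eps%:E)%E]) /\
    (fun eps => (n eps)%:R : R) =o_ (0^'+)
      (fun eps => eps `^ (- (2 / p%:R)) : R).
Proof.
have [K K0 KV] := snapshot_space hT hp hc hu0 hu.
(* Integrating over [0, T] gives K T / (N + 1) ^ (2 p), and K T <= A ^ 2. *)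
pose A := 1 + K * T.
have KT0 : 0 <= K * T by rewrite mulr_ge0// ltW.
have A1 : 1 <= A by rewrite lerDl.
have A0 : 0 <= A by exact: le_trans A1.
pose N eps := Num.truncn (A * eps `^ (- p%:R^-1)).
have /choice[V /choice[n Vn]] eps := KV (N eps).
exists V, n; split; last first.
  by apply: (little_o_rate hp A0) => eps _; have [] := Vn eps.
move=> eps eps0; have [Vsub Vdim _ Vbound] := Vn eps; split=> //.
have p0 : 0 < p%:R :> R by rewrite ltr0n.
have Neps : A / eps <= (N eps).+1%:R ^+ p.
  apply: (@le_trans _ _ ((A * eps `^ (- p%:R^-1)) ^+ p)).
    rewrite exprMn -(powR_mulrn p (powR_ge0 _ _)) -powRrM mulNr mulVf ?gt_eqF//.
    rewrite powR_inv1 ?(ltW eps0)// ler_pM2r ?invr_gt0//.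
    by rewrite -{1}[A]expr1 ler_weXn2l.
  rewrite lerXn2r ?nnegrE ?mulr_ge0 ?powR_ge0//.
  by apply/ltW; rewrite truncnS_gt.
have int_le : (\int[lebesgue_measure]_(t in `[0%R, T])
    (L2_norm (fun x => L2_proj (V eps) (u ^~ t) x - u x t)%R `^ 2) <=
    (eps ^+ 2)%:E)%E.
  apply: (@le_trans _ _
      ((K / (N eps).+1%:R ^+ p.*2)%:E * lebesgue_measure [set` `[0%R, T]])%E).
    apply: ge0_integral_le_cst => // t; rewrite /= in_itv/= => tT.
    by rewrite poweR_ge0 Vbound.
  rewrite lebesgue_measure_itv/= lte_fin hT sube0 -EFinM lee_fin.
  rewrite mulrAC ler_pdivrMr ?exprn_gt0//.
  apply: (@le_trans _ _ (eps ^+ 2 * (A / eps) ^+ 2)); last first.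
    rewrite ler_wpM2l ?sqr_ge0// -muln2 exprM.
    by rewrite lerXn2r ?nnegrE ?divr_ge0 ?(ltW eps0)// exprn_ge0.
  rewrite -exprMn mulrCA divff ?gt_eqF// mulr1.
  apply: (@le_trans _ _ A); first by rewrite lerDr.
  by rewrite -{1}[A]expr1 ler_weXn2l.
apply: (@le_trans _ _ ((eps ^+ 2)%:E `^ 2^-1)%E).
  apply: gt0_ler_poweR => //; rewrite in_itv/= leey andbT.
    by apply: integral_ge0 => t _; exact: poweR_ge0.
  by rewrite lee_fin sqr_ge0.
by rewrite poweR_EFin powR12_sqrt ?sqr_ge0// sqrtr_sqr gtr0_norm.
Qed.
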